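(* Let $(X,d)$ be a metric space with basepoint $e\in X$. The function $d_{\mathbb{N}[X]}:\mathrm{SP}(X)\times \mathrm{SP}(X)\to\mathbb{R}_{\ge 0}$ (the matching distance) is well defined (i.e. independent of the lists chosen to represent the two elements) and is a metric on the set $\mathrm{SP}(X)$.
   Context: Let $(X,d)$ be a metric space with distinguished basepoint $e\in X$. For $n\ge 1$, $\mathrm{SP}^n(X)=X^n/S_n$ is the quotient of $X^n$ by the coordinate-permutation action of the symmetric group $S_n$; the orbit of $(x_1,\dots,x_n)$ is written $[x_1,\dots,x_n]$. The map $[x_1,\dots,x_n]\mapsto[x_1,\dots,x_n,e]$ embeds $\mathrm{SP}^n(X)$ in $\mathrm{SP}^{n+1}(X)$, and the set $\mathrm{SP}(X)$ is the union $\bigcup_{n\ge1}\mathrm{SP}^n(X)$ of the increasing sequence so obtained. Thus elements of $\mathrm{SP}(X)$ are finite unordered lists $[x_1,\dots,x_m]$ of points of $X$, with $[x_1,\dots,x_m]=[x_1,\dots,x_m,e]$. Matching distance: for $[x_1,\dots,x_m],[y_1,\dots,y_n]\in \mathrm{SP}(X)$ and $N\ge m+n$ let $\mathbf{x}_N=(x_1,\dots,x_m,e,\dots,e)$ and $\mathbf{y}_N=(y_1,\dots,y_n,e,\dots,e)$ be the lists padded with copies of $e$ to length $N$, and let $\mathbf{x}_N(i)$, $\mathbf{y}_N(i)$ be their $i$-th entries. Then $$d_{\mathbb{N}[X]}([x_1,\dots,x_m],[y_1,\dots,y_n]):=\inf_{N\ge m+n}\ \min_{\sigma\in S_N}\ \sum_{i=1}^N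 d\bigl(\mathbf{x}_N(i),\mathbf{y}_N(\sigma(i))\bigr).$$ *)

(* Defs.v *)
From HB Require Import structures.
From mathcomp Require Import all_boot all_order all_algebra all_fingroup.
From mathcomp Require Import all_classical all_reals all_analysis.

Set Implicit Arguments.
Unset Strict Implicit.
Unset Printing Implicit Defensive.

Import Order.TTheory GRing.Theory Num.Theory.

Local Open Scope classical_set_scope.
Local Open Scope ring_scope.
Local Open Scope quotient_scope.

Section SymmetricPower.
Context {X : choiceType}.

Definition sym_orbit_rel (n : nat) : rel (n.-tuple X) :=
  fun x y => [exists s : 'S_n, y == [tuple tnth x (s i) | i < n]].

Lemma sym_orbit_relE n (x y : n.-tuple X) : sym_orbit_rel x y = perm_eq y x.
Proof.
apply/existsP/tuple_permP => -[s].
  by move=> /eqP ->; exists s.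
by move=> yx; exists s; apply/eqP/val_inj.
Qed.

Lemma sym_orbit_rel_refl n : reflexive (@sym_orbit_rel n).
Proof. by move=> x; rewrite sym_orbit_relE. Qed.

Lemma sym_orbit_rel_sym n : symmetric (@sym_orbit_rel n).
Proof. by move=> x y; rewrite !sym_orbit_relE perm_sym. Qed.

Lemma sym_orbit_rel_trans n : transitive (@sym_orbit_rel n).
Proof.
move=> y x z; rewrite !sym_orbit_relE => yx zy; exact: perm_trans zy yx.
Qed.

Canonical sym_orbit_equiv n := EquivRel (@sym_orbit_rel n)
  (@sym_orbit_rel_refl n) (@sym_orbit_rel_sym n) (@sym_orbit_rel_trans n).

End SymmetricPower.

Definition SPn (X : choiceType) (n : nat) : choiceType :=
  {eq_quot (@sym_orbit_equiv X n)}.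

Definition SPn_class (X : choiceType) (n : nat) (x : n.-tuple X) : SPn X n :=
  \pi_({eq_quot (@sym_orbit_equiv X n)}) x.

Definition SPn_repr (X : choiceType) (n : nat) (a : SPn X n) : n.-tuple X :=
  generic_quotient.repr (a : {eq_quot (@sym_orbit_equiv X n)}).

Definition SPn_embed (X : choiceType) (e : X) (n : nat) (a : SPn X n) :
  SPn X n.+1 := SPn_class [tuple of rcons (SPn_repr a) e].

Lemma SPn_classP (X : choiceType) (n : nat) (x y : n.-tuple X) :
  SPn_class x = SPn_class y <-> sym_orbit_rel x y.
Proof.
split; first by move/eqmodP.
by move=> xy; apply/eqmodP.
Qed.

Lemma SPn_reprK (X : choiceType) (n : nat) (a : SPn X n) :
  SPn_class (SPn_repr a) = a.
Proof. exact: generic_quotient.reprK. Qed.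

Lemma SPn_embedE (X : choiceType) (e : X) (n : nat) (x : n.-tuple X) :
  SPn_embed e (SPn_class x) = SPn_class [tuple of rcons x e].
Proof.
apply/SPn_classP; rewrite sym_orbit_relE /= -!cats1 perm_cat2r.
by rewrite -sym_orbit_relE; apply/SPn_classP; rewrite SPn_reprK.
Qed.

Lemma SPn_embed_inj (X : choiceType) (e : X) (n : nat) :
  injective (@SPn_embed X e n).
Proof.
move=> a b /SPn_classP; rewrite sym_orbit_relE /= -!cats1 perm_cat2r.
by rewrite -sym_orbit_relE => /SPn_classP; rewrite !SPn_reprK.
Qed.

(* The union of the SP^n(X), n >= 1, along the embeddings is their direct
   limit.  SP^n(X) is the summand of index n.-1, and [SP_step] sends a point of
   any summand to its image in the next one. *)
Definition SP_level (X : choiceType) : choiceType := {n : nat & SPn X n.+1}.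

Definition SP_step (X : choiceType) (e : X) (u : SP_level X) : SP_level X :=
  Tagged (fun n => SPn X n.+1) (SPn_embed e (tagged u)).

Section Union.
Context {X : choiceType} (e : X).

Definition SP_rel : rel (SP_level X) := fun u v =>
  `[< exists k l : nat, iter k (SP_step e) u = iter l (SP_step e) v >].

Lemma SP_rel_refl : reflexive SP_rel.
Proof. by move=> u; apply/asboolP; exists 0%N, 0%N. Qed.

Lemma SP_rel_sym : symmetric SP_rel.
Proof.
by move=> u v; apply/asboolP/asboolP => -[k [l kl]]; exists l, k; rewrite kl.
Qed.

Lemma SP_rel_trans : transitive SP_rel.
Proof.
move=> v u w /asboolP[k [l kl]] /asboolP[p [q pq]]; apply/asboolP.
exists (p + k)%N, (l + q)%N.
by rewrite iterD kl -iterD addnC iterD pq -iterD.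
Qed.

Canonical SP_equiv := EquivRel SP_rel SP_rel_refl SP_rel_sym SP_rel_trans.

End Union.

Definition SP (X : choiceType) (e : X) : choiceType := {eq_quot (SP_equiv e)}.

(* [x_1, ..., x_m] as an element of SP(X), for m = n.+1 >= 1 *)
Definition SP_class (X : choiceType) (e : X) (n : nat) (x : n.+1.-tuple X) :
    SP e :=
  \pi_({eq_quot (SP_equiv e)}) (Tagged (fun n => SPn X n.+1) (SPn_class x)).

Section MatchingDistance.
Context {R : realType} {X : metricType R} (e : X).

(* [nth e x i] is the i-th entry of x followed by copies of e. *)
Definition matching_cost (N : nat) (x y : seq X) (s : 'S_N) : R :=
  \sum_(i < N) mdist (nth e x i) (nth e y (s i)).

(* The minimum over S_N; the neutral value used by the big operator is the cost
   of the identity permutation, which is itself one of the terms. *)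
Definition min_matching_cost (N : nat) (x y : seq X) : R :=
  \big[Num.min/matching_cost x y (1%g : 'S_N)]_(s : 'S_N) matching_cost x y s.

Definition list_matching_dist (x y : seq X) : R :=
  inf [set min_matching_cost N x y | N in [set N | (size x + size y <= N)%N]].

(* A list of positive length representing a given element of SP(X) *)
Definition SP_repr (a : SP e) : seq X :=
  SPn_repr (tagged (generic_quotient.repr (a : {eq_quot (SP_equiv e)}))).

Definition matching_dist (a b : SP e) : R :=
  list_matching_dist (SP_repr a) (SP_repr b).

End MatchingDistance.

Definition is_metric (R : realType) (T : Type) (d : T -> T -> R) : Prop :=
  [/\ forall a b, 0 <= d a b,
      forall a b, d a b = 0 <-> a = b,
      forall a b, d a b = d b a &
      forall a b c, d a c <= d a b + d b c].

(* Main.v *)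
Require Import Defs.
From mathcomp Require Import all_boot all_order all_algebra all_fingroup.
From mathcomp Require Import all_classical all_reals all_analysis.

(** Pad both lists with copies of [e] to a common length [N].  The minimum cost
    over [S_N] behaves like a distance: it is nonnegative, inverting a
    permutation gives symmetry, composing two optimal permutations gives the
    triangle inequality, and the cost vanishes exactly when the padded lists
    are permutations of each other.

    The substance is that this minimum does not depend on [N] as soon as both
    lists fit in length [N] ([min_matching_costS]).  A permutation of [N]
    indices extends by fixing the new index, at cost [d(e, e) = 0].
    Conversely, when the last entries of both padded lists are [e], a
    permutation that matches [x_i] with the last entry of the second list and
    the last entry of the first list with [y_j] costs at least as much, by the
    triangle inequality through [e], as the one that matches [x_i] with [y_j]
    and [e] with [e]; and the latter fixes the last index.  So the infimum
    defining the matching distance is one of these minima, at any sufficiently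
    large length ([list_matching_distE]), and a length common to any number of
    lists can be chosen.  The matching distance is thus a pseudometric on lists.

    Two lists represent the same element of [SP e] exactly when they become
    permutations of each other after padding, that is, when they are at
    distance zero ([SP_class_dist0]).  Independence of the representatives and
    the separation axiom both follow from this equivalence. *)

Set Implicit Arguments.
Unset Strict Implicit.
Unset Printing Implicit Defensive.

Import Order.TTheory GRing.Theory Num.Theory.

Local Open Scope ring_scope.

(** * Permutations fixing the last index *)

(** The permutation of the smaller index set is read off from [s] through
    [unlift]; the default value of [odflt] is never taken, because [s] sends no
    other index to the last one. *)
Lemma perm_fix_max_lift (n : nat) (s : 'S_n.+1) :
  s ord_max = ord_max -> exists t : 'S_n, s = lift_perm ord_max ord_max t.
Proof.
move=> smax.
pose g (k : 'I_n) : 'I_n := odflt k (unlift ord_max (s (lift ord_max k))).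
have gE k : lift ord_max (g k) = s (lift ord_max k).
  rewrite /g; case: unliftP => [j -> //|/=].
  rewrite -[in RHS]smax => /perm_inj/eqP.
  by rewrite eq_sym (negPf (neq_lift _ _)).
have g_inj : injective g.
  move=> k l gkl; apply: (@lift_inj _ ord_max); apply: (@perm_inj _ s).
  by rewrite -!gE gkl.
exists (perm g_inj); apply/permP => i.
have [k ->|->] := unliftP ord_max i.
  by rewrite lift_perm_lift permE gE.
by rewrite lift_perm_id.
Qed.

Section MatchingCost.
Context {R : realType} {X : metricType R} (e : X).
Implicit Types x y z : seq X.

(** * Costs at a fixed length *)

Lemma matching_cost_ge0 N x y (s : 'S_N) : 0 <= matching_cost e x y s.
Proof. by apply: sumr_ge0 => i _; exact: mdist_ge0. Qed.

Lemma min_matching_cost_le N x y (s : 'S_N) :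
  min_matching_cost e N x y <= matching_cost e x y s.
Proof. exact: bigmin_le. Qed.

(** The neutral value of the big operator is the cost of the identity, so it
    too is attained. *)
Lemma min_matching_cost_attained N x y :
  exists s : 'S_N, min_matching_cost e N x y = matching_cost e x y s.
Proof.
have /bigmin_leP[le1|[s _ les]] := lexx (min_matching_cost e N x y).
  by exists 1%g; apply/le_anti; rewrite le1 min_matching_cost_le.
by exists s; apply/le_anti; rewrite les min_matching_cost_le.
Qed.

Lemma min_matching_cost_ge0 N x y : 0 <= min_matching_cost e N x y.
Proof.
by have [s ->] := min_matching_cost_attained N x y; exact: matching_cost_ge0.
Qed.

Lemma matching_costV N x y (s : 'S_N) :
  matching_cost e y x s^-1%g = matching_cost e x y s.
Proof.
rewrite /matching_cost (reindex_inj (@perm_inj _ s)) /=.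
by apply: eq_bigr => i _; rewrite permK metric_sym.
Qed.

Lemma min_matching_cost_sym N x y :
  min_matching_cost e N x y = min_matching_cost e N y x.
Proof.
have half u v : min_matching_cost e N u v <= min_matching_cost e N v u.
  have [s ->] := min_matching_cost_attained N v u.
  by rewrite -matching_costV min_matching_cost_le.
by apply/le_anti; rewrite !half.
Qed.

Lemma matching_cost_trans N x y z (s t : 'S_N) :
  matching_cost e x z (s * t)%g <=
  matching_cost e x y s + matching_cost e y z t.
Proof.
rewrite [X in _ + X](reindex_inj (@perm_inj _ s)) -big_split /=.
by apply: ler_sum => i _; rewrite permM metric_triangle.
Qed.

Lemma min_matching_cost_triangle N x y z :
  min_matching_cost e N x z <=
  min_matching_cost e N x y + min_matching_cost e N y z.
Proof.
have [s ->] := min_matching_cost_attained N x y.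
have [t ->] := min_matching_cost_attained N y z.
exact: le_trans (min_matching_cost_le _ _ _) (matching_cost_trans _ _ _ _ _).
Qed.

Lemma matching_cost_eq0 N x y (s : 'S_N) :
  matching_cost e x y s = 0 <-> forall i : 'I_N, nth e x i = nth e y (s i).
Proof.
split=> [/psumr_eq0P cost0 i|xy]; last first.
  by apply: big1 => i _; rewrite xy mdistxx.
by apply: mdist_positivity; apply: cost0 => // j _; exact: mdist_ge0.
Qed.

Lemma min_matching_cost_eq0 N x y :
  min_matching_cost e N x y = 0 <->
  perm_eq (mkseq (nth e x) N) (mkseq (nth e y) N).
Proof.
have mkseqE u : mkseq (nth e u) N = [tuple nth e u i | i < N].
  by rewrite /mkseq /= -val_enum_ord -map_comp.
rewrite (mkseqE y); split.
  have [s ->] := min_matching_cost_attained N x y.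
  move=> /matching_cost_eq0 xy; apply/tuple_permP; exists s.
  rewrite mkseqE; congr val; apply: eq_from_tnth => i.
  by rewrite !tnth_mktuple xy.
rewrite mkseqE => /tuple_permP[s /val_inj xy].
apply/le_anti; rewrite min_matching_cost_ge0 andbT.
apply: le_trans (min_matching_cost_le _ _ s) _.
rewrite le_eqVlt; apply/orP; left; apply/eqP/matching_cost_eq0 => i.
by have := congr1 (fun t => tnth t i) xy; rewrite !tnth_mktuple.
Qed.

(** * Independence of the length *)

Lemma matching_cost_lift_perm N x y (s : 'S_N) :
  (size x <= N)%N -> (size y <= N)%N ->
  matching_cost e x y (lift_perm ord_max ord_max s) = matching_cost e x y s.
Proof.
move=> xN yN; rewrite /matching_cost big_ord_recr /= lift_perm_id /=.
rewrite !nth_default // mdistxx addr0; apply: eq_bigr => i _.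
have -> : widen_ord (leqnSn N) i = lift ord_max i.
  exact/val_inj/esym/lift_max.
by rewrite lift_perm_lift !lift_max.
Qed.

(** Exchanging the images of the last index and of its preimage replaces
    [d(x_i, e) + d(e, y_j)] by [d(x_i, y_j)]. *)
Lemma matching_cost_shortcut N x y (s : 'S_N.+1) :
  (size x <= N)%N -> (size y <= N)%N ->
  matching_cost e x y (s * tperm (s ord_max) ord_max)%g <= matching_cost e x y s.
Proof.
move=> xN yN.
have [smax|smax] := eqVneq (s ord_max) ord_max.
  by rewrite smax tperm1 mulg1.
pose i := (s^-1)%g ord_max.
have si : s i = ord_max by rewrite /i permKV.
have imax : i != ord_max by apply: contra_neq smax => im; rewrite -[in LHS]im.
rewrite /matching_cost (bigD1 ord_max) //= (bigD1 i) //=.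
rewrite [leRHS](bigD1 ord_max) //= [X in _ <= _ + X](bigD1 i) //=.
rewrite !permM tpermL si tpermR !addrA.
have -> : nth e x N = e by rewrite nth_default.
have -> : nth e y N = e by rewrite nth_default.
rewrite mdistxx add0r; apply: lerD.
  by rewrite [leRHS]addrC metric_triangle.
apply: ler_sum => k /andP[kmax ki].
rewrite permM tpermD //.
  by rewrite (inj_eq perm_inj) eq_sym.
by rewrite -si (inj_eq perm_inj) eq_sym.
Qed.

Lemma min_matching_costS N x y : (size x <= N)%N -> (size y <= N)%N ->
  min_matching_cost e N.+1 x y = min_matching_cost e N x y.
Proof.
move=> xN yN; apply/le_anti/andP; split.
  have [s ->] := min_matching_cost_attained N x y.
  by rewrite -matching_cost_lift_perm // min_matching_cost_le.
have [s ->] := min_matching_cost_attained N.+1 x y.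
apply: le_trans (matching_cost_shortcut s xN yN).
have [|t ->] := @perm_fix_max_lift _ (s * tperm (s ord_max) ord_max)%g.
  by rewrite permM tpermL.
by rewrite matching_cost_lift_perm // min_matching_cost_le.
Qed.

Lemma min_matching_cost_leq M N x y : (size x <= M)%N -> (size y <= M)%N ->
  (M <= N)%N -> min_matching_cost e N x y = min_matching_cost e M x y.
Proof.
move=> xM yM /subnK <-; elim: (N - M)%N => // k IH.
by rewrite addSn min_matching_costS // (leq_trans _ (leq_addl _ _)).
Qed.

(** All the minima in the defining infimum are equal, so it is the infimum of a
    singleton. *)
Lemma list_matching_distE N x y : (size x <= N)%N -> (size y <= N)%N ->
  list_matching_dist e x y = min_matching_cost e N x y.
Proof.
move=> xN yN; rewrite /list_matching_dist -[RHS]inf1; congr inf.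
have stable M : (size x + size y <= M)%N ->
    min_matching_cost e M x y = min_matching_cost e N x y.
  move=> xyM; have [xM yM] : (size x <= M)%N /\ (size y <= M)%N.
    by split; apply: leq_trans xyM; rewrite ?leq_addr ?leq_addl.
  have [NM|/ltnW MN] := leqP N M; first exact: min_matching_cost_leq.
  by rewrite [RHS](min_matching_cost_leq xM yM).
apply/seteqP; split=> [_ [M /= xyM <-]|_ ->]; first exact: stable.
by exists (size x + size y)%N => //=; rewrite stable.
Qed.

(** * The pseudometric on lists *)

Lemma list_matching_dist_ge0 x y : 0 <= list_matching_dist e x y.
Proof.
rewrite (@list_matching_distE (size x + size y)) ?leq_addr ?leq_addl //.
exact: min_matching_cost_ge0.
Qed.

Lemma list_matching_dist_sym x y :
  list_matching_dist e x y = list_matching_dist e y x.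
Proof.
rewrite !(@list_matching_distE (size x + size y)) ?leq_addr ?leq_addl //.
exact: min_matching_cost_sym.
Qed.

Lemma list_matching_dist_triangle x y z :
  list_matching_dist e x z <= list_matching_dist e x y + list_matching_dist e y z.
Proof.
pose N := (size x + size y + size z)%N.
have [xN yN zN] : [/\ size x <= N, size y <= N & size z <= N]%N.
  by rewrite /N; split; rewrite ?leq_addl // -?addnA ?leq_addr // addnCA leq_addr.
rewrite !(@list_matching_distE N) //; exact: min_matching_cost_triangle.
Qed.

(** A pseudometric descends to the quotient by distance zero: this is what makes
    the distance independent of the representatives. *)
Lemma list_matching_dist_eq x x' y y' :
  list_matching_dist e x x' = 0 -> list_matching_dist e y y' = 0 ->
  list_matching_dist e x y = list_matching_dist e x' y'.
Proof.
have half u u' v v' : list_matching_dist e u u' = 0 ->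
    list_matching_dist e v v' = 0 ->
    list_matching_dist e u v <= list_matching_dist e u' v'.
  move=> uu' vv'; apply: le_trans (list_matching_dist_triangle u u' v) _.
  rewrite uu' add0r; apply: le_trans (list_matching_dist_triangle u' v' v) _.
  by rewrite (list_matching_dist_sym v') vv' addr0.
move=> xx' yy'; apply/le_anti.
by rewrite !half // list_matching_dist_sym.
Qed.

Lemma mkseq_nth_pad x k : mkseq (nth e x) (size x + k) = x ++ nseq k e.
Proof.
apply: (@eq_from_nth _ e) => [|i]; rewrite size_mkseq.
  by rewrite size_cat size_nseq.
move=> ik; rewrite nth_mkseq // nth_cat nth_nseq if_same.
by case: ltnP => // /(nth_default e).
Qed.

(** Distance zero forces a permutation at length [size x + size y]; conversely
    a permutation after any padding gives cost zero at the corresponding length,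
    which is enough because the length does not matter. *)
Lemma list_matching_dist_eq0 x y :
  list_matching_dist e x y = 0 <->
  exists k l, perm_eq (x ++ nseq k e) (y ++ nseq l e).
Proof.
split=> [|[k [l xy]]].
  rewrite (@list_matching_distE (size x + size y)) ?leq_addr ?leq_addl //.
  move=> /min_matching_cost_eq0; rewrite mkseq_nth_pad addnC mkseq_nth_pad.
  by move=> xy; exists (size y), (size x).
have /eqP := perm_size xy; rewrite !size_cat !size_nseq => /eqP kl.
rewrite (@list_matching_distE (size x + k)) ?leq_addr //; last first.
  by rewrite kl leq_addr.
by apply/min_matching_cost_eq0; rewrite {2}kl !mkseq_nth_pad.
Qed.

End MatchingCost.

(** * Lists as representatives of elements of the union *)

Section Representatives.
Context {X : choiceType} (e : X).

Definition level_class (n : nat) (x : n.+1.-tuple X) : SP_level X :=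
  Tagged (fun n => SPn X n.+1) (SPn_class x).

Lemma level_class_eq n m (x : n.+1.-tuple X) (y : m.+1.-tuple X) :
  level_class x = level_class y <-> perm_eq x y.
Proof.
split=> [xy|xy].
  have reprE k (t : k.+1.-tuple X) :
      perm_eq t (SPn_repr (tagged (level_class t))).
    by rewrite -sym_orbit_relE; apply/SPn_classP; rewrite SPn_reprK.
  by rewrite (perm_trans (reprE _ x)) // xy perm_sym reprE.
have := perm_size xy; rewrite !size_tuple => -[nm].
case: m / nm y xy => y xy.
by congr Tagged; apply/SPn_classP; rewrite sym_orbit_relE perm_sym.
Qed.

Lemma iter_SP_step n (x : n.+1.-tuple X) k :
  exists m (t : m.+1.-tuple X),
    iter k (SP_step e) (level_class x) = level_class t /\
    val t = x ++ nseq k e.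
Proof.
elim: k => [|k [m [t [IH tE]]]]; first by exists n, x; rewrite cats0.
exists m.+1, [tuple of rcons t e]; split.
  by rewrite iterS IH /SP_step /level_class /= SPn_embedE.
by rewrite -[k.+1]addn1 nseqD /= tE rcons_cat cats1.
Qed.

(** Iterating the step map appends copies of [e] up to permutation, so meeting at
    a later stage of the direct limit means agreeing after padding. *)
Lemma SP_class_eq n m (x : n.+1.-tuple X) (y : m.+1.-tuple X) :
  SP_class e x = SP_class e y <->
  exists k l, perm_eq (x ++ nseq k e) (y ++ nseq l e).
Proof.
have stepE k l : iter k (SP_step e) (level_class x) =
      iter l (SP_step e) (level_class y) <->
    perm_eq (x ++ nseq k e) (y ++ nseq l e).
  have [p [t [-> <-]]] := iter_SP_step x k.
  have [q [u [-> <-]]] := iter_SP_step y l.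
  exact: level_class_eq.
split=> [/eqmodP/asboolP|] [k [l /stepE xy]]; first by exists k, l.
by apply/eqmodP/asboolP; exists k, l.
Qed.

End Representatives.

Lemma SP_reprP (R : realType) (X : metricType R) (e : X) (a : SP e) :
  exists n (t : n.+1.-tuple X), SP_repr a = t /\ a = SP_class e t.
Proof.
rewrite /SP_repr; set u := generic_quotient.repr _.
exists (tag u), (SPn_repr (tagged u)); split=> //.
rewrite /SP_class SPn_reprK -[LHS]generic_quotient.reprK.
by congr (generic_quotient.pi _ _); rewrite -/u; case: u.
Qed.

(** Padding to a permutation is the common description of both sides: the left
    one by the direct limit, the right one by the optimal permutation. *)
Lemma SP_class_dist0 (R : realType) (X : metricType R) (e : X) n m
    (x : n.+1.-tuple X) (y : m.+1.-tuple X) :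
  SP_class e x = SP_class e y <-> list_matching_dist e x y = 0.
Proof.
split=> [/SP_class_eq|]; first by move=> /list_matching_dist_eq0.
by move=> /list_matching_dist_eq0/SP_class_eq.
Qed.

Theorem proposition3p2 (R : realType) (X : metricType R) (e : X) :
  (forall (m m' n n' : nat)
      (x : m.+1.-tuple X) (x' : m'.+1.-tuple X)
      (y : n.+1.-tuple X) (y' : n'.+1.-tuple X),
      SP_class e x = SP_class e x' -> SP_class e y = SP_class e y' ->
      list_matching_dist e x y = list_matching_dist e x' y')
  /\ (forall (m n : nat) (x : m.+1.-tuple X) (y : n.+1.-tuple X),
        matching_dist (SP_class e x) (SP_class e y) = list_matching_dist e x y)
  /\ is_metric (@matching_dist R X e).
Proof.
have well_def m m' n n' (x : m.+1.-tuple X) (x' : m'.+1.-tuple X)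
    (y : n.+1.-tuple X) (y' : n'.+1.-tuple X) :
    SP_class e x = SP_class e x' -> SP_class e y = SP_class e y' ->
    list_matching_dist e x y = list_matching_dist e x' y'.
  by move=> /SP_class_dist0 xx' /SP_class_dist0 yy'; exact: list_matching_dist_eq.
split; [exact: well_def|split].
  move=> m n x y; rewrite /matching_dist.
  have [p [t [-> xt]]] := SP_reprP (SP_class e x).
  have [q [u [-> yu]]] := SP_reprP (SP_class e y).
  exact: well_def.
split=> [a b|a b|a b|a b c]; rewrite /matching_dist.
- exact: list_matching_dist_ge0.
- have [p [t [-> ->]]] := SP_reprP a; have [q [u [-> ->]]] := SP_reprP b.
  by split=> /SP_class_dist0.
- exact: list_matching_dist_sym.
- exact: list_matching_dist_triangle.
Qed.
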